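(* Let $\mathcal{P}\subset K[x_1,\ldots,x_n]$ be a chordal polynomial set with $x_1<\cdots<x_n$ as a perfect elimination ordering. Let $\overline{\mathrm{red}}_n(\mathcal{P}),\ldots,\overline{\mathrm{red}}_1(\mathcal{P})$ be any successive reduction of $\mathcal{P}$, with arbitrary valid reduction data at each step. Then $G(\overline{\mathrm{red}}_i(\mathcal{P}))\subseteq G(\mathcal{P})$ for every $i=n,\ldots,1$.
   Context: Let $K$ be a field and $K[x_1,\ldots,x_n]$ the polynomial ring, with the variables ordered $x_1<\cdots<x_n$. For a polynomial $F$, $\mathrm{supp}(F)$ is the set of variables effectively appearing in $F$. For a set of polynomials $\mathcal{P}$, $\mathrm{supp}(\mathcal{P})=\bigcup_{F\in\mathcal{P}}\mathrm{supp}(F)$. For a nonconstant $F$, $\mathrm{lv}(F)$ is the greatest variable in $\mathrm{supp}(F)$. For a polynomial set $\mathcal{P}$ and $1\le i\le n$, $\mathcal{P}^{(i)}=\{P\in\mathcal{P}:\mathrm{lv}(P)=x_i\}$; constants belong to no $\mathcal{P}^{(i)}$. The associated graph $G(\mathcal{P})$ is the undirected graph whose vertex set is $\mathrm{supp}(\mathcal{P})$, with an edge between distinct $x_i,x_j$ iff some $F\in\mathcal{P}$ has $x_i,x_j\in\mathrm{supp}(F)$. For graphs, $G\subseteq G'$ means that $G$ is a subgraph of $G'$, i.e. both the vertex set and the edge set are contained. An ordering of the vertices of a graph is a perfect elimination ordering if, for every vertex $v$, the set consisting of $v$ and all neighbours of $v$ smaller than $v$ is a clique. A polynomial set $\mathcal{P}$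 is called chordal with $x_1<\cdots<x_n$ as a perfect elimination ordering if the restriction of this ordering to $\mathrm{supp}(\mathcal{P})$ is a perfect elimination ordering of $G(\mathcal{P})$. Reduction step: let $\mathcal{S}$ be a polynomial set and $1\le i\le n$ with $\mathcal{S}^{(i)}\neq\emptyset$. Reduction data for $(\mathcal{S},i)$ is a pair $(T_i,\mathcal{R}_i)$ such that: - $T_i\in K[x_1,\ldots,x_i]\setminus K[x_1,\ldots,x_{i-1}]$ and $\mathcal{R}_i\subset K[x_1,\ldots,x_{i-1}]$, where $K[x_1,\ldots,x_0]=K$; - $\mathrm{supp}(T_i)\subseteq\mathrm{supp}(\mathcal{S}^{(i)})$ and $\mathrm{supp}(\mathcal{R}_i)\subseteq\mathrm{supp}(\mathcal{S}^{(i)})$. Given such a pair, $$\mathrm{red}_i(\mathcal{S})=\bigcup_{j>i}\mathcal{S}^{(j)}\ \cup\ \{T_i\}\ \cup\ \bigcup_{j<i}\big(\mathcal{S}^{(j)}\cup\mathcal{R}_i^{(j)}\big).$$ If $\mathcal{S}^{(i)}=\emptyset$, set $\mathrm{red}_i(\mathcal{S})=\bigcup_{j}\mathcal{S}^{(j)}$. Successive reduction: $\overline{\mathrm{red}}_{n+1}(\mathcal{P})=\mathcal{P}$ and $\overline{\mathrm{red}}_i(\mathcal{P})=\mathrm{red}_i(\overline{\mathrm{red}}_{i+1}(\mathcal{P}))$ for $i=n,\ldots,1$. At each step some reduction data for $(\overline{\mathrm{red}}_{i+1}(\mathcal{P}),i)$ is chosen. *)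

(* Defs.v *)
(* Multivariate polynomials are not available in the installed
   libraries, so K[x_1,...,x_n] is built as iterated univariate polynomials:
   mpoly K 0 = K, mpoly K (n+1) = (mpoly K n)[x_{n+1}]. Variables are
   represented by natural numbers 1..n (variable k stands for x_k). *)
From HB Require Import structures.
From mathcomp Require Import all_boot all_order all_algebra.
Set Implicit Arguments. Unset Strict Implicit. Unset Printing Implicit Defensive.
Import GRing.Theory.
Local Open Scope ring_scope.

Section MPoly.
Variable K : fieldType.

Fixpoint mpoly (n : nat) : nzRingType :=
  match n with
  | 0 => K
  | n'.+1 => ({poly mpoly n'} : nzRingType)
  end.

(* suppv n p k : the variable x_k effectively appears in p *)
Fixpoint suppv (n : nat) : mpoly n -> nat -> bool :=
  match n return mpoly n -> nat -> bool with
  | 0 => fun _ _ => false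
  | n'.+1 => fun (p : {poly mpoly n'}) k =>
      ((k == n'.+1) && (1 < size p)%N) || has (fun c => suppv c k) (polyseq p)
  end.

Variable n : nat.
Notation P := (mpoly n).

(* leading variable index (0 for constants; variables are 1..n) *)
Definition lv (F : P) : nat := (\max_(k < n.+1 | suppv F k) k)%N.

Definition nonconst (F : P) : bool := (0 < lv F)%N.

Definition supp_set (S : seq P) (k : nat) : Prop :=
  exists2 F, F \in S & suppv F k.

Definition level (S : seq P) (i : nat) : seq P := [seq F <- S | lv F == i].

Definition gedge (S : seq P) (j k : nat) : Prop :=
  j <> k /\ exists2 F, F \in S & suppv F j && suppv F k.

Definition subgraph (S S' : seq P) : Prop :=
  (forall k, supp_set S k -> supp_set S' k) /\
  (forall j k, gedge S j k -> gedge S' j k).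

(* x_1 < ... < x_n restricted to supp(S) is a perfect elimination ordering
   of G(S): for every vertex v, v together with its smaller neighbours is
   a clique. *)
Definition chordal (S : seq P) : Prop :=
  forall v, supp_set S v ->
  forall u w,
    (u = v \/ (gedge S u v /\ (u < v)%N)) ->
    (w = v \/ (gedge S w v /\ (w < v)%N)) ->
    u <> w -> gedge S u w.

Definition red_data (S : seq P) (i : nat) (T : P) (R : seq P) : Prop :=
  (forall k, suppv T k -> (k <= i)%N) /\ suppv T i /\
  (forall G, G \in R -> forall k, suppv G k -> (k < i)%N) /\
  (forall k, suppv T k -> supp_set (level S i) k) /\
  (forall G, G \in R -> forall k, suppv G k -> supp_set (level S i) k).

(* red_i(S) for given reduction data (T, R), when S^(i) is nonempty:
   union_{j>i} S^(j) ∪ {T} ∪ union_{j<i} (S^(j) ∪ R^(j)), j ranging over 1..n *)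
Definition red (S : seq P) (i : nat) (T : P) (R : seq P) : seq P :=
  [seq F <- S | (i < lv F)%N] ++ [:: T] ++
  [seq F <- S | (0 < lv F < i)%N] ++ [seq G <- R | (0 < lv G < i)%N].

(* red_i(S) when S^(i) is empty: union_j S^(j) *)
Definition red_empty (S : seq P) : seq P := [seq F <- S | nonconst F].

Definition red_step (i : nat) (S S' : seq P) : Prop :=
  (level S i = [::] /\ S' = red_empty S) \/
  (level S i <> [::] /\ exists T R, red_data S i T R /\ S' = red S i T R).

Definition successive_reduction (P0 : seq P) (Sred : nat -> seq P) : Prop :=
  Sred n.+1 = P0 /\
  forall i, (1 <= i <= n)%N -> red_step i (Sred i.+1) (Sred i).

End MPoly.

(* Main.v *)
(* Every polynomial kept by a reduction step already lies in the previous set,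
   and every new polynomial (T_i or an element of R_i) has its support inside
   supp(S^(i)).  By induction on the steps G(S) is a subgraph of G(P), so every
   variable of supp(S^(i)) is x_i or a smaller neighbour of x_i in G(P); by the
   perfect elimination property these variables form a clique of G(P).  Hence
   the new polynomials create neither new vertices nor new edges. *)
Require Import Defs.
From mathcomp Require Import all_boot all_order all_algebra zify.

Set Implicit Arguments. Unset Strict Implicit.

Lemma nat_down_ind (P : nat -> Prop) (l m : nat) :
  P m -> (forall i, (l <= i < m)%N -> P i.+1 -> P i) ->
  forall i, (l <= i <= m)%N -> P i.
Proof.
move=> Pm step i /andP[li im].
suff down k : (k <= m - l)%N -> P (m - k) by have := down (m - i); rewrite subKn //; apply; lia.
elim: k => [_|k IH lekm]; first by rewrite subn0.
apply: step; first lia.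
have -> : ((m - k.+1).+1 = m - k)%N by lia.
by apply: IH; lia.
Qed.

Section LeadingVariable.
Variables (K : fieldType) (n : nat).
Implicit Type F : mpoly K n.

Lemma suppv_leq (m : nat) (p : mpoly K m) k : suppv p k -> (k <= m)%N.
Proof.
elim: m p => [//|m IH] p /=.
case/orP => [/andP[/eqP -> _] //|/hasP[c _ /IH]].
exact: leqW.
Qed.

Lemma leq_lv F k : suppv F k -> (k <= lv F)%N.
Proof.
move=> Fk; have k_lt : (k < n.+1)%N by rewrite ltnS (suppv_leq Fk).
exact: (leq_bigmax_cond (Ordinal k_lt)).
Qed.

Lemma suppv_lv F : (0 < lv F)%N -> suppv F (lv F).
Proof.
have : (lv F == 0%N) || suppv F (lv F).
  apply: (big_ind (fun m => (m == 0%N) || suppv F m)) => //= [x y|i ->].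
    by rewrite /maxn; case: ltnP.
  by rewrite orbT.
by case/orP => [/eqP ->|].
Qed.

End LeadingVariable.

Section ReductionStep.
Variables (K : fieldType) (n : nat) (P0 : seq (mpoly K n)).
Hypothesis P0_chordal : chordal P0.
Implicit Type S : seq (mpoly K n).

Lemma supp_level S i j : (0 < i)%N -> supp_set (level S i) j ->
  exists2 F, F \in S & [/\ suppv F j, suppv F i & (j <= i)%N].
Proof.
move=> i_gt0 [F]; rewrite mem_filter => /andP[/eqP lvF FS] Fj.
exists F => //; split => //; last by rewrite -lvF leq_lv.
by rewrite -lvF suppv_lv // lvF.
Qed.

Lemma supp_level_clique S i j k : (0 < i)%N -> subgraph S P0 ->
  supp_set (level S i) j -> supp_set (level S i) k -> j <> k -> gedge P0 j k.
Proof.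
move=> i_gt0 [subV subE] Sj Sk jk.
have [F FS [Fj Fi ji]] := supp_level i_gt0 Sj.
have [G GS [Gk Gi ki]] := supp_level i_gt0 Sk.
have lower_nbr l H : H \in S -> suppv H l -> suppv H i -> (l <= i)%N ->
    l = i \/ gedge P0 l i /\ (l < i)%N.
  move=> HS Hl Hi li; case: (eqVneq l i) => [->|l_ne_i]; [by left | right].
  split; last by rewrite ltn_neqAle l_ne_i.
  by apply: subE; split; [exact/eqP | exists H => //; rewrite Hl Hi].
apply: (P0_chordal (v := i)) => //; last exact: lower_nbr GS Gk Gi ki.
- by apply: subV; exists F.
- exact: lower_nbr FS Fj Fi ji.
Qed.

Lemma subgraph_extend S S' i : (0 < i)%N -> subgraph S P0 ->
  (forall F, F \in S' -> F \in S \/ forall k, suppv F k -> supp_set (level S i) k) ->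
  subgraph S' P0.
Proof.
move=> i_gt0 subSP S'_from; have [subV subE] := subSP; split.
  move=> k [F /S'_from[FS|Flev] Fk]; first by apply: subV; exists F.
  have [G GS [Gk _ _]] := supp_level i_gt0 (Flev k Fk).
  by apply: subV; exists G.
move=> j k [jk [F /S'_from[FS|Flev] /andP[Fj Fk]]].
  by apply: subE; split => //; exists F => //; rewrite Fj Fk.
exact: supp_level_clique subSP (Flev j Fj) (Flev k Fk) jk.
Qed.

Lemma red_step_subgraph S S' i : (0 < i)%N -> subgraph S P0 ->
  red_step i S S' -> subgraph S' P0.
Proof.
move=> i_gt0 subSP [[_ ->]|[_ [T [R [[_ [_ [_ [suppT suppR]]]] ->]]]]].
  by apply: subgraph_extend i_gt0 subSP _ => F; rewrite mem_filter => /andP[_]; left.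
apply: subgraph_extend i_gt0 subSP _ => F.
rewrite !mem_cat !mem_filter inE.
case/or4P => [/andP[_ FS]|/eqP ->|/andP[_ FS]|/andP[_ FR]]; [by left|by right|by left|].
by right; apply: suppR.
Qed.

End ReductionStep.

Theorem theorem3p5 (K : fieldType) (n : nat) (P0 : seq (mpoly K n))
  (Sred : nat -> seq (mpoly K n)) :
  chordal P0 ->
  successive_reduction P0 Sred ->
  forall i, (1 <= i <= n)%N -> subgraph (Sred i) P0.
Proof.
move=> P0_chordal [Sred_top Sred_step] i /andP[i_ge1 i_le_n].
apply: (@nat_down_ind (fun i => subgraph (Sred i) P0) 1 n.+1); last by rewrite i_ge1 ltnW.
  by rewrite Sred_top.
move=> j /andP[j_gt0 j_le_n] /= sub_next.
apply: (red_step_subgraph P0_chordal j_gt0 sub_next).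
by apply: Sred_step; rewrite j_gt0.
Qed.
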